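(* For every integer $k\ge 2$ and every positive integer $n$, \[ \mathrm{ex}_3\big(n, C^{(3)}_{2k+1}\big)\le t_{2k+1}(n)+4\,\mathrm{ex}(n,C_{2k})+12\,\mathrm{ex}^{\mathrm{lin}}_3\big(n, C^{(3)}_{2k+1}\big). \]
   Context: A 3-uniform hypergraph is a set of 3-element subsets (hyperedges) of a vertex set. A Berge cycle of length $m$ in a hypergraph is a family of $m$ distinct hyperedges $H_0,\dots,H_{m-1}$ for which there exist distinct vertices $v_0,\dots,v_{m-1}$ with $\{v_i,v_{i+1}\}\subset H_i$ for $0\le i\le m-1$ (indices mod $m$). $C^{(3)}_m$ denotes the family of 3-uniform Berge cycles of length $m$; a hypergraph is $C^{(3)}_m$-free if it contains no Berge cycle of length $m$. A hypergraph is linear if any two distinct hyperedges share at most one vertex. $\mathrm{ex}_3(n,C^{(3)}_m)$ (resp. $\mathrm{ex}^{\mathrm{lin}}_3(n,C^{(3)}_m)$) is the maximum number of hyperedges in a 3-uniform (resp. 3-uniform linear) hypergraph on $n$ vertices with no Berge cycle of length $m$. $\mathrm{ex}(n,C_{2k})$ is the maximum number of edges of a simple graph on $n$ vertices with no cycle of length $2k$. $t_\ell(n)$ is the maximum number of triangles in a simple graph on $n$ vertices containing no cycle of length $\ell$. *)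

(* Defs.v *)
From mathcomp Require Import all_boot.
Set Implicit Arguments. Unset Strict Implicit. Unset Printing Implicit Defensive.

Definition uniform3 n (E : {set {set 'I_n}}) : bool := [forall e in E, #|e| == 3].

Definition linear_hg n (E : {set {set 'I_n}}) : bool :=
  [forall e in E, forall f in E, (e != f) ==> (#|e :&: f| <= 1)].

Definition has_berge_cycle n m (E : {set {set 'I_n}}) : bool :=
  [exists H : {ffun 'I_m -> {set 'I_n}}, exists v : {ffun 'I_m -> 'I_n},
     [&& injectiveb H, injectiveb v &
         [forall i : 'I_m, [&& H i \in E, v i \in H i & v (ordS i) \in H i]]]].

Definition ex3 n m : nat :=
  \max_(E : {set {set 'I_n}} | uniform3 E && ~~ has_berge_cycle m E) #|E|.

Definition ex3_lin n m : nat :=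
  \max_(E : {set {set 'I_n}} | [&& uniform3 E, linear_hg E & ~~ has_berge_cycle m E])
     #|E|.

Definition simple_graph n (G : {set {set 'I_n}}) : bool := [forall e in G, #|e| == 2].

Definition has_cycle n l (G : {set {set 'I_n}}) : bool :=
  [exists v : {ffun 'I_l -> 'I_n},
     injectiveb v && [forall i : 'I_l, [set v i; v (ordS i)] \in G]].

Definition ex_graph n l : nat :=
  \max_(G : {set {set 'I_n}} | simple_graph G && ~~ has_cycle l G) #|G|.

Definition triangles n (G : {set {set 'I_n}}) : nat :=
  #|[set T : {set 'I_n} | (#|T| == 3) &&
      [forall x in T, forall y in T, (x != y) ==> ([set x; y] \in G)]]|.

Definition t_tri n l : nat :=
  \max_(G : {set {set 'I_n}} | simple_graph G && ~~ has_cycle l G) triangles G.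

(* Main.v *)
(* Let [E] be extremal. The pairs of codegree at least 2 form a graph without
   (2k+1)-cycles, so the hyperedges all of whose pairs are such are among its
   triangles. Any other hyperedge [e] has an apex [a e] for which [e :\ a e] lies
   in no other hyperedge. A random 2-colouring of the vertices gives the apex
   and the remaining pair opposite colours with probability 1/4, so keep such a
   quarter of these hyperedges. Among the kept ones, those with a pair
   [x, a e] of codegree at least 3 are counted by the graph of the pairs
   [e :\ a e], which has no 2k-cycle since the apex of one of its edges would
   extend it to a Berge (2k+1)-cycle; each of the others meets at most two of
   the others in two vertices, so a third of them form a linear hypergraph. *)
Require Import Defs.
From mathcomp Require Import all_boot.
From mathcomp Require Import zify.
Set Implicit Arguments. Unset Strict Implicit. Unset Printing Implicit Defensive.

(** * Cycles indexed by natural numbers *)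

Lemma modn_addl_neq m i d : 0 < d < m -> (i + d = i %[mod m]) -> False.
Proof.
move=> /andP[d0 dm] /eqP; rewrite -{2}[i]addn0 eqn_modDl mod0n modn_small //.
by move/eqP=> dE; rewrite dE in d0.
Qed.

(** Periodic extension of the cycle: successors become plain [i.+1], and wrap-around turns into
    congruence modulo [l]. *)
Lemma cycle_nat n l (G : {set {set 'I_n}}) : 0 < l -> has_cycle l G ->
  exists2 v : nat -> 'I_n, forall i j, v i = v j <-> i = j %[mod l]
    & forall i, [set v i; v i.+1] \in G.
Proof.
move=> l0 /existsP[v /andP[/injectiveP vI /forallP vG]].
pose o i : 'I_l := Ordinal (ltn_pmod i l0).
exists (fun i => v (o i)) => [i j|i].
  split=> [/vI /(congr1 val)|ij] //=.
  by congr (v _); apply: val_inj.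
suff -> : o i.+1 = ordS (o i) by [].
by apply: val_inj => /=; rewrite -addn1 -modnDml addn1.
Qed.

Lemma berge_nat n m (E : {set {set 'I_n}}) (H : nat -> {set 'I_n}) (v : nat -> 'I_n) :
  (forall i j, i < j < m -> H i <> H j) -> (forall i j, i < j < m -> v i <> v j) ->
  (forall i, i < m -> H i \in E) -> (forall i, i < m -> v i \in H i) ->
  (forall i, i < m -> v (i.+1 %% m) \in H i) ->
  has_berge_cycle m E.
Proof.
have inj T (f : nat -> T) :
    (forall i j, i < j < m -> f i <> f j) -> injective (fun i : 'I_m => f i).
  move=> fI i j fij; apply: val_inj; case: (ltngtP i j) => // ij.
    by case: (fI i j); rewrite // ij /=.
  by case: (fI j i); rewrite // ij /=.
move=> HI vI HE vH vSH.
apply/existsP; exists [ffun i : 'I_m => H i].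
apply/existsP; exists [ffun i : 'I_m => v i]; apply/and3P; split.
- by apply/injectiveP => i j; rewrite !ffunE => /inj; apply.
- by apply/injectiveP => i j; rewrite !ffunE => /inj; apply.
- by apply/forallP => i; rewrite !ffunE HE // vH //= vSH.
Qed.

Lemma has_berge_cycleS n m (M E : {set {set 'I_n}}) :
  M \subset E -> has_berge_cycle m M -> has_berge_cycle m E.
Proof.
move=> /subsetP ME /existsP[H /existsP[v /and3P[HI vI /forallP h]]].
apply/existsP; exists H; apply/existsP; exists v; rewrite HI vI /=.
by apply/forallP => i; have /and3P[/ME-> -> ->] := h i.
Qed.

Lemma cards3 (T : finType) (x y z : T) :
  y != x -> z != x -> z != y -> #|[set x; y; z]| = 3.
Proof.
move=> yx zx zy; rewrite -setUA cardsU1 cards2 !inE negb_or.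
by rewrite (eq_sym x) yx (eq_sym x) zx (eq_sym y) zy.
Qed.

(** * Berge cycles from pairs of large codegree *)

Section Codegree.

Variables (n : nat) (E : {set {set 'I_n}}).
Hypothesis E3 : forall e, e \in E -> #|e| = 3.

Definition through (P : {set 'I_n}) := [set e in E | P \subset e].
Definition codeg P := #|through P|.
Definition thick_graph := [set P : {set 'I_n} | (#|P| == 2) && (1 < codeg P)].

Lemma codeg_avoid1 P T : 1 < codeg P -> exists2 f, f \in through P & f != T.
Proof.
rewrite /codeg (cardsD1 T) => h.
have /card_gt0P[f] : 0 < #|through P :\ T| by move: h; case: (_ \in _); lia.
by rewrite inE => /andP[] fT fP; exists f => //; rewrite -in_set1.
Qed.

Lemma codeg_avoid2 P T U : 2 < codeg P ->
  exists f, [/\ f \in through P, f != T & f != U].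
Proof.
rewrite /codeg (cardsD1 T) (cardsD1 U) => h.
have /card_gt0P[f] : 0 < #|through P :\ T :\ U|.
  by move: h; case: (_ \in _); case: (_ \in _); lia.
by rewrite !inE => /and3P[] fU fT fP; exists f; rewrite !inE.
Qed.

(* Only [{v_i, v_(i+1), v_(i+2)}] can contain two edges of the cycle, the
   first one being [v_i v_(i+1)]; so an injective choice of hyperedges is
   obtained by avoiding it at each edge. *)
Lemma thick_cycle m : 2 < m -> has_cycle m thick_graph -> has_berge_cycle m E.
Proof.
move=> m2 /(cycle_nat (ltn_trans _ m2))[//|v vP vG].
pose T i := [set v i; v i.+1; v i.+2].
have vD i d : 0 < d < m -> v (i + d) != v i.
  by move=> dm; apply/eqP => /vP; apply: modn_addl_neq.
have vS i : v i.+1 != v i by rewrite -addn1 vD; lia.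
have vSS i : v i.+2 != v i by rewrite -addn2 vD; lia.
have TE f i : f \in E -> v i \in f -> v i.+1 \in f -> v i.+2 \in f -> f = T i.
  move=> fE f0 f1 f2; apply/esym/eqP; rewrite eqEcard E3 //.
  rewrite cards3 // andbT.
  by apply/subsetP => x; rewrite !inE => /orP[/orP[]|]/eqP->.
have pick_ex i : exists f, (f \in through [set v i; v i.+1]) && (f != T i).
  have := vG i; rewrite inE => /andP[_ /(codeg_avoid1 (T i))[f f1 f2]].
  by exists f; rewrite f1.
pose H i := xchoose (pick_ex i).
have [HE H0 H1 HT] : [/\ forall i, H i \in E, forall i, v i \in H i,
    forall i, v i.+1 \in H i & forall i, H i <> T i].
  split=> i; have := xchooseP (pick_ex i); rewrite -/(H i) inE subUset !sub1set.
  - by case/andP=> /andP[].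
  - by case/andP=> /and3P[].
  - by case/andP=> /and3P[].
  - by case/andP=> _ /eqP.
have vmod i : v (i %% m) = v i by apply/vP; rewrite modn_mod.
apply: (@berge_nat _ _ _ H v) => // [i j ijm Hij|i j ijm|i _|i im]; last first.
- by rewrite vmod.
- exact: HE.
- have -> : j = i + (j - i) by lia.
  by apply/eqP; rewrite eq_sym vD; lia.
have vij : v j != v i.
  have -> : j = i + (j - i) by lia.
  by apply: vD; lia.
(* If edges [i] and [j] are consecutive, in either cyclic order, a shared hyperedge contains three
   successive vertices and so equals the avoided [T i] or [T j]. *)
case: (v i.+1 =P v j) => [/vP e1|n1].
  apply: (HT i); apply: TE => //.
  suff -> : v i.+2 = v j.+1 by rewrite Hij.
  by apply/vP; rewrite -addn1 -[j.+1]addn1 -modnDml e1 modnDml.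
case: (v j.+1 =P v i) => [/vP e1|n2].
  apply: (HT j); apply: TE => //.
  suff -> : v j.+2 = v i.+1 by rewrite -Hij.
  by apply/vP; rewrite -addn1 -[i.+1]addn1 -modnDml e1 modnDml.
have n3 : v j.+1 != v i.+1.
  have -> : j.+1 = i.+1 + (j - i) by lia.
  by apply: vD; lia.
(* Otherwise the two edges are disjoint, and four distinct vertices would lie in a hyperedge of size
   3. *)
have u4 : uniq [:: v j.+1; v j; v i.+1; v i].
  rewrite /= !inE !negb_or !vS n3 vij !andbT /=.
  by apply/andP; split; apply/eqP => // /esym.
have := E3 (HE i); rewrite cardE => s3.
have : size [:: v j.+1; v j; v i.+1; v i] <= size (enum (H i)).
  apply: uniq_leq_size => // x.
  by rewrite mem_enum !inE => /or4P[]/eqP->; rewrite ?H0 ?H1 // Hij ?H0 ?H1.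
by rewrite s3.
Qed.

(* The first edge [v_0 v_1] of the cycle is replaced by a path through the apex
   [a (e 0)], one hyperedge of which is [e 0]; the cycle avoids this apex since
   all its vertices have the opposite colour. *)
Lemma apex_cycle l (D : {set {set 'I_n}}) (a : {set 'I_n} -> 'I_n)
    (c : 'I_n -> bool) : 2 < l -> D \subset E ->
  (forall e, e \in D -> a e \in e) ->
  (forall e x, e \in D -> x \in e :\ a e -> c x != c (a e)) ->
  (forall e, e \in D -> exists2 x, x \in e :\ a e & 2 < codeg [set x; a e]) ->
  has_cycle l [set e :\ a e | e in D] -> has_berge_cycle l.+1 E.
Proof.
move=> l2 DE aD cD thickD /(cycle_nat (ltn_trans _ l2))[//|v vP vG].
have vN i j : i < j < i + l -> v i <> v j.
  move=> ij; have -> : j = i + (j - i) by lia.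
  by move/esym/vP; apply: modn_addl_neq; lia.
have e_ex i : exists e, (e \in D) && (e :\ a e == [set v i; v i.+1]).
  by have /imsetP[e eD ->] := vG i; exists e; rewrite eD eqxx.
pose e i := xchoose (e_ex i).
have eD i : e i \in D by have /andP[] := xchooseP (e_ex i).
have eE i : e i :\ a (e i) = [set v i; v i.+1].
  by have /andP[_ /eqP] := xchooseP (e_ex i).
have v0e i : v i \in e i :\ a (e i) by rewrite eE !inE eqxx.
have v1e i : v i.+1 \in e i :\ a (e i) by rewrite eE !inE eqxx orbT.
have ev0 i : v i \in e i by have := v0e i; rewrite inE => /andP[].
have ev1 i : v i.+1 \in e i by have := v1e i; rewrite inE => /andP[].
(* Equal hyperedges would carry the same edge read backwards; this forces [j = i.+1] and then
   [v i = v i.+2], excluded by [2 < l]. *)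
have eI i j : i < j < l -> e i <> e j.
  move=> ijl eij; have := v1e i; have := v0e i; rewrite eij eE !inE.
  case/orP=> /eqP h0; first by move=> _; move: h0; apply: vN; lia.
  move=> /orP[]/eqP h1; last by move: h1; apply: vN; lia.
  have [ji|/eqP ji] := eqVneq j i.+1; last by move: h1; apply: vN; lia.
  by move: h0; apply: vN; lia.
pose z := a (e 0).
(* Both ends of edge [i] have the colour opposite to [a (e i)], so the colour is constant along the
   cycle. *)
have cv i : c (v i) != c z.
  elim: i => [|i ih]; first exact: cD (v0e 0).
  have := cD _ _ (eD i) (v0e i); have := cD _ _ (eD i) (v1e i).
  by move: ih; case: (c (v i)); case: (c (v i.+1)); case: (c z); case: (c _).
have vz i : v i <> z by move=> h; have := cv i; rewrite h eqxx.
have ze0 : z \in e 0 by exact: aD.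
(* A hyperedge [e j] containing [z] has [z] as its apex, so its only cycle vertices are the ends of
   edge [j]. *)
have apexE i j : v i \in e j -> z \in e j -> v i = v j \/ v i = v j.+1.
  move=> ij zj.
  have za : z = a (e j).
    apply/eqP; apply: contraT => zn.
    have : z \in e j :\ a (e j) by rewrite !inE zn.
    by rewrite eE !inE => /orP[]/eqP/esym/vz.
  have : v i \in e j :\ a (e j) by rewrite !inE ij -za andbT; apply/eqP/vz.
  by rewrite eE !inE => /orP[]/eqP; [left|right].
(* Only the hyperedges of the two cycle edges at [v i] could contain both [v i] and [z]; codegree 3
   leaves one besides these. The predecessor of edge 0 is [l.-1]. *)
have avoid i : i < 2 -> 2 < codeg [set v i; z] -> exists f,
    [/\ f \in E, v i \in f, z \in f & forall j, j < l -> f <> e j].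
  move=> i2 /(codeg_avoid2 (e i) (e (if i == 0 then l.-1 else 0)))[f [fP fi fl]].
  move: fP; rewrite inE subUset !sub1set => /and3P[fE fv fz].
  exists f; split=> // j jl fj.
  move: fv fz; rewrite fj => /apexE h /h [].
    have [ij|/eqP ij] := eqVneq i j; first by rewrite ij fj eqxx in fi.
    have [ltij|leji] := ltnP i j; first by apply: vN; lia.
    by move/esym; apply: vN; lia.
  have [ij|ij] := eqVneq i 0; move: fl; rewrite ?ij ?(negPf ij) /= => /eqP fl.
    have [jl1|/eqP jl1] := eqVneq j l.-1; first by rewrite jl1 in fj.
    by apply: vN; lia.
  have [j0|/eqP j0] := eqVneq j 0; first by rewrite j0 in fj.
  by apply: vN; lia.
(* The path from [v 0] to [v 1] through [z] uses [h] and then [g]. Whichever of [v 0], [v 1] forms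
   the pair of codegree at least 3 with [z] gets the new hyperedge; the other keeps [e 0]. *)
have [g [h [[gE hE gz hz] [g1 h0 gh] [gN hN]]]] : exists g h,
    [/\ [/\ g \in E, h \in E, z \in g & z \in h],
         [/\ v 1 \in g, v 0 \in h & g <> h]
       & (forall j, 0 < j < l -> g <> e j) /\ (forall j, 0 < j < l -> h <> e j)].
  have e0E := subsetP DE _ (eD 0).
  have [x] := thickD _ (eD 0); rewrite eE !inE => /orP[]/eqP-> /avoid[//|f].
    move=> [fE f0 fz fN]; exists (e 0), f; split; split=> //.
    + by move/esym; apply: fN; lia.
    + by move=> j jl; apply: eI; lia.
    + by move=> j jl; apply: fN; lia.
  move=> [fE f0 fz fN]; exists f, (e 0); split; split=> //.
  + by apply: fN; lia.
  + by move=> j jl; apply: fN; lia.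
  + by move=> j jl; apply: eI; lia.
have vl : v l = v 0 by apply/vP; rewrite modnn mod0n.
clear avoid apexE.
(* The new cycle is [z, v 1, ..., v l]: the apex takes index 0, and [v 0] reappears as [v l]. *)
pose w i := if i == 0 then z else v i.
pose H i := if i == 0 then g else if i == l then h else e i.
apply: (@berge_nat _ _ _ H w) => [i j ijl|i j ijl|i il|i il|i il]; rewrite /H /w.
- have -> : (j == 0) = false by lia.
  case: (i =P 0) => [i0|i0]; case: (j =P l) => [jl|jl] //.
  + by apply: gN; lia.
  + have -> : (i == l) = false by lia.
    by apply/nesym/hN; lia.
  + have -> : (i == l) = false by lia.
    by apply: eI; lia.
- have -> : (j == 0) = false by lia.
  case: (i =P 0) => [i0|i0]; first exact/nesym.
  by apply: vN; lia.
- by case: ifP => // _; case: ifP => // _; apply: (subsetP DE).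
- case: (i =P 0) => [//|i0]; case: (i =P l) => [->|//].
  by rewrite vl.
- have [->|/eqP il'] := eqVneq i l.
    by rewrite modnn eqxx; case: (l =P 0) => //; lia.
  rewrite modn_small /=; last by lia.
  by case: (i =P 0) => [->|//].
Qed.

End Codegree.

(** * Selection by colouring and by maximality *)

(* The parity pattern of a colouring on [x, y, z], up to swapping the colours,
   is one of four; each of the flips below brings one of them to the pattern
   where [z] is singled out. *)
Lemma split_colouring n (S : {set {set 'I_n}}) (z : {set 'I_n} -> 'I_n) :
  (forall e, e \in S -> #|e| = 3 /\ z e \in e) ->
  exists c : {ffun 'I_n -> bool},
    #|S| <= 4 * #|[set e in S | [forall x in e :\ z e, c x != c (z e)]]|.
Proof.
move=> SP.
pose good (c : {ffun 'I_n -> bool}) e := [forall x in e :\ z e, c x != c (z e)].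
have half e : e \in S ->
    #|{ffun 'I_n -> bool}| <= 4 * \sum_(c : {ffun 'I_n -> bool}) good c e.
  move=> /SP[e3 ze].
  have /cards2P[x [y [xy exy]]] : #|e :\ z e| == 2.
    by move: e3; rewrite (cardsD1 (z e)) ze add1n => -[->].
  have xz : x != z e.
    by have : x \in e :\ z e; [rewrite exy !inE eqxx | rewrite !inE => /andP[]].
  have yz : y != z e.
    by have : y \in e :\ z e; [rewrite exy !inE eqxx orbT | rewrite !inE => /andP[]].
  have goodE c : good c e = (c x != c (z e)) && (c y != c (z e)).
    apply/forall_inP/andP => [h|[h1 h2] u].
      by split; apply: h; rewrite exy !inE eqxx ?orbT.
    by rewrite exy !inE => /orP[]/eqP->.
  pose flip w (c : {ffun 'I_n -> bool}) := [ffun u => c u (+) (u == w)].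
  have flipI w : injective (flip w).
    by apply: (can_inj (g := flip w)) => c; apply/ffunP => u; rewrite !ffunE addbK.
  have sumF w : \sum_c (good (flip w c) e : nat) = \sum_c (good c e : nat).
    by rewrite [RHS](reindex_inj (@flipI w)).
  rewrite -sum1_card.
  have -> : 4 * \sum_c (good c e : nat) = \sum_c (good c e
      + good (flip x c) e + good (flip y c) e + good (flip (z e) c) e).
    by rewrite !big_split /= !sumF !mulSn mul0n addn0 !addnA.
  apply: leq_sum => c _; rewrite !goodE !ffunE !eqxx.
  rewrite ![z e == _]eq_sym [y == x]eq_sym (negPf xy) (negPf xz) (negPf yz).
  by case: (c x); case: (c y); case: (c (z e)).
(* Were every colouring to fall short by at least 1, summing over all colourings would contradict
   the bound [half] summed over [S]. *)
apply/existsP; apply: contraT; rewrite negb_exists => /forallP bad.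
have : \sum_(e in S) #|{ffun 'I_n -> bool}| <=
    4 * \sum_(c : {ffun 'I_n -> bool}) #|[set e in S | good c e]|.
  apply: (@leq_trans (\sum_(e in S) 4 * \sum_(c : {ffun 'I_n -> bool}) good c e)).
    exact: leq_sum.
  rewrite -big_distrr /= exchange_big /= leq_mul2l /=.
  apply: leq_sum => c _; rewrite -sum1_card big_mkcond /= [leqRHS]big_mkcond /=.
  by apply: leq_sum => e _; rewrite inE; case: (e \in S) => //=; case: (good c e).
have : \sum_(c : {ffun 'I_n -> bool}) (4 * #|[set e in S | good c e]| + 1) <=
    \sum_(c : {ffun 'I_n -> bool}) #|S|.
  by apply: leq_sum => c _; rewrite addn1 ltnNge; apply: bad.
have c0 : 0 < #|{ffun 'I_n -> bool}| by apply/card_gt0P; exists [ffun=> true].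
rewrite big_split /= -big_distrr /= !sum_nat_const.
rewrite muln1 [#|_| * #|S|]mulnC => h1 /(leq_trans h1).
by rewrite -[leqRHS]addn0 leq_add2l leqNgt c0.
Qed.

(** For an inclusion-maximal linear [M], each member of [L] is in [M] or meets some member of [M] in
    two vertices. Hence the closed neighbourhoods [N e], of size at most [d.+1], cover [L]. *)
Lemma linear_subfamily n (L : {set {set 'I_n}}) d :
  (forall e, e \in L -> #|[set f in L | (f != e) && (1 < #|e :&: f|)]| <= d) ->
  exists2 M : {set {set 'I_n}}, M \subset L /\ linear_hg M & #|L| <= d.+1 * #|M|.
Proof.
move=> Ld.
pose P (M : {set {set 'I_n}}) := (M \subset L) && linear_hg M.
have P0 : P set0.
  by rewrite /P sub0set; apply/forall_inP => e; rewrite inE.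
have [M /maxsetP[/andP[ML Mlin] Mmax] _] := maxset_exists P0.
exists M => //.
pose N e := e |: [set f in L | (f != e) && (1 < #|e :&: f|)].
have NM : L \subset \bigcup_(e in M) N e.
  apply/subsetP => f fL; apply/bigcupP; apply/exists_inP.
  apply: contraT; rewrite negb_exists_in => /forall_inP h.
  have fM : f \notin M by apply/negP => /h; rewrite !inE eqxx.
  have small e : e \in M -> #|e :&: f| <= 1.
    move=> eM; have := h _ eM; rewrite !inE fL negb_or /= negb_and negbK -leqNgt.
    by case/andP=> /negPf->.
  case/negP: fM; rewrite -(Mmax (f |: M)) ?setU11 ?subsetUr //.
  rewrite /P subUset sub1set fL ML /=.
  apply/forall_inP => e; rewrite in_setU1 => /orP[/eqP->|eM];
    apply/forall_inP => g; rewrite in_setU1 => /orP[/eqP->|gM]; apply/implyP.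
  - by rewrite eqxx.
  - by rewrite setIC small.
  - by rewrite small.
  - by have /forall_inP/(_ _ eM)/forall_inP/(_ _ gM)/implyP := Mlin.
apply: leq_trans (subset_leq_card NM) _.
have sumN (r : seq {set 'I_n}) : #|\bigcup_(e <- r | e \in M) N e| <= \sum_(e <- r | e \in M) #|N e|.
  elim/big_rec2: _ => [|e b A _ le]; first by rewrite cards0.
  by apply: leq_trans (leq_card_setU _ _) _; rewrite leq_add2l.
apply: leq_trans (sumN _) _.
rewrite mulnC -sum_nat_const.
apply: leq_sum => e /(subsetP ML)/Ld; rewrite cardsU1; case: (_ \notin _) => /=; lia.
Qed.

(** * Splitting and counting the hyperedges *)

Theorem theorem2 (k n : nat) (hk : 2 <= k) (hn : 0 < n) :
  ex3 n (2 * k + 1) <=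
  t_tri n (2 * k + 1) + 4 * ex_graph n (2 * k) + 12 * ex3_lin n (2 * k + 1).
Proof.
apply/bigmax_leqP => /= E /andP[/forall_inP E3b freeE].
have E3 e : e \in E -> #|e| = 3 by move/E3b/eqP.
pose light (e : {set 'I_n}) := [pick z in e | codeg E (e :\ z) <= 1].
pose E2 := [set e in E | light e]; pose E1 := E :\: E2.
have cardE : #|E| = #|E1| + #|E2|.
  rewrite -(cardsID E2 E) addnC; congr (_ + #|pred_of_set _|).
  by apply/setIidPr/subsetP => e; rewrite inE => /andP[].
have E1le : #|E1| <= t_tri n (2 * k + 1).
  apply: (@leq_trans (triangles (thick_graph E))); last first.
    apply: (@leq_bigmax_cond _ _ (fun G : {set {set 'I_n}} => triangles G)).
    apply/andP; split; first by apply/forall_inP => P; rewrite inE => /andP[].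
    by apply: contra freeE; apply: thick_cycle => //; lia.
  apply/subset_leq_card/subsetP => e; rewrite !inE /light => /andP[+ eE].
  rewrite eE E3 //=; case: pickP => // noz _.
  apply/forall_inP => x xe; apply/forall_inP => y ye; apply/implyP => xy.
  rewrite inE cards2 xy /=.
  have /card_gt0P[z] : 0 < #|e :\ x :\ y|.
    by have := E3 _ eE; rewrite (cardsD1 x e) xe (cardsD1 y) !inE eq_sym xy ye; lia.
  rewrite !inE => /and3P[zy zx ze].
  have := noz z; rewrite /= ze /= leqNgt => /negbFE; congr (_ < codeg _ _).
  apply/esym/eqP; rewrite eqEcard subUset !sub1set !inE xe ye.
  rewrite (eq_sym x) (eq_sym y) zx zy cards2 xy /=.
  by have := E3 _ eE; rewrite (cardsD1 z e) ze add1n => -[->].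
(* The default vertex is reached only outside [E2]. *)
pose a e := odflt (Ordinal hn) (light e).
have E2P e : e \in E2 -> [/\ e \in E, a e \in e & codeg E (e :\ a e) <= 1].
  by rewrite inE /a /light; case: pickP => [z /andP[? ?]|_] /andP[].
have E2S e : e \in E2 -> #|e| = 3 /\ a e \in e by case/E2P=> /E3.
have [c cle] := split_colouring E2S.
set S := [set e in E2 | _] in cle.
have SE2 e : e \in S -> e \in E2 by rewrite inE => /andP[].
have Sc e x : e \in S -> x \in e :\ a e -> c x != c (a e).
  by rewrite inE => /andP[_ /forall_inP]; apply.
pose D := [set e in S | [exists x in e :\ a e, 2 < codeg E [set x; a e]]].
pose L := S :\: D.
have cardS : #|S| = #|D| + #|L|.
  rewrite -(cardsID D S); congr (#|pred_of_set _| + _).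
  by apply/setIidPr/subsetP => e; rewrite inE => /andP[].
have DS e : e \in D -> e \in S by rewrite inE => /andP[].
(* This makes [e :\ a e] injective on [D], and forces an [f] in [L] that shares two vertices with
   another [e] to contain [a e]. *)
have pair_uniq e f : e \in E2 -> f \in E -> e :\ a e \subset f -> f = e.
  case/E2P => eE ae /card_le1_eqP h fE ef.
  by apply: h; rewrite inE ?eE ?fE ?ef ?subD1set.
have Dle : #|D| <= ex_graph n (2 * k).
  have <- : #|[set e :\ a e | e in D]| = #|D|.
    apply: card_in_imset => e f /DS/SE2 eD /DS/SE2 fD ef.
    by apply: pair_uniq; [|have [] := E2P _ eD|rewrite -ef subD1set].
  apply: (@leq_bigmax_cond _ _ (fun G : {set {set 'I_n}} => #|G|)).
  apply/andP; split.
    apply/forall_inP => P /imsetP[e /DS/SE2/E2S[e3 ae] ->].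
    by move: e3; rewrite (cardsD1 (a e)) ae add1n => -[->].
  apply: contra freeE; rewrite addn1; apply: (apex_cycle (c := c)) => //.
  - by lia.
  - by apply/subsetP => e /DS/SE2/E2P[].
  - by move=> e /DS/SE2/E2P[].
  - by move=> e x /DS; apply: Sc.
  - by move=> e; rewrite inE => /andP[_ /exists_inP[x]]; exists x.
have Lle : #|L| <= 3 * ex3_lin n (2 * k + 1).
  (* Such an [f] contains [a e] and one more vertex of [e], hence one of the two pairs at the apex;
     each has codegree at most 2 and so lies in at most one hyperedge besides [e]. *)
  have deg2 e : e \in L -> #|[set f in L | (f != e) && (1 < #|e :&: f|)]| <= 2.
    rewrite inE => /andP[eD eS].
    have [eE ae _] := E2P _ (SE2 _ eS).
    have small x : x \in e :\ a e -> #|through E [set x; a e] :\ e| <= 1.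
      move=> xe; have : codeg E [set x; a e] <= 2.
        rewrite leqNgt; apply: contra eD => h; rewrite inE eS.
        by apply/exists_inP; exists x.
      rewrite /codeg (cardsD1 e) inE eE subUset !sub1set ae.
      by move: xe; rewrite inE => /andP[_ ->].
    have /cards2P[x [y [xy exy]]] : #|e :\ a e| == 2.
      by have := E3 _ eE; rewrite (cardsD1 (a e)) ae add1n => -[->].
    have := small x; have := small y; rewrite exy !inE !eqxx orbT.
    move=> /(_ isT) sy /(_ isT) sx.
    apply: leq_trans (leq_add sx sy); apply: leq_trans (leq_card_setU _ _).
    apply/subset_leq_card/subsetP => f; rewrite inE => /and3P[/setDP[/SE2 fE2 _] fe ef].
    have [fE _ _] := E2P f fE2.
    rewrite !inE fe fE !subUset !sub1set /=.
    case af: (a e \in f); rewrite ?andbT ?andbF /=.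
      apply: contraLR ef; rewrite negb_or -leqNgt => /andP[xf yf].
      rewrite -(cards1 (a e)); apply/subset_leq_card/subsetP => u.
      rewrite !inE => /andP[ue uf]; apply: contraT => ua.
      have : u \in e :\ a e by rewrite !inE ua.
      by rewrite exy !inE => /orP[]/eqP uE; rewrite -uE uf in xf yf.
    case/eqP: fe; apply: pair_uniq => //; first exact: SE2.
    have /eqP<- : e :&: f == e :\ a e; last exact: subsetIr.
    rewrite eqEcard exy cards2 xy ef andbT -exy; apply/subsetP => u.
    by rewrite !inE => /andP[-> uf]; rewrite andbT; apply: contraTneq uf => ->; rewrite af.
  have [M [ML Mlin] /leq_trans-> //] := linear_subfamily deg2.
  rewrite leq_mul2l /=.
  apply: (@leq_bigmax_cond _ _ (fun G : {set {set 'I_n}} => #|G|)).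
  have ME e : e \in M -> e \in E.
    by move/(subsetP ML); rewrite inE => /andP[_ /SE2/E2P[]].
  apply/and3P; split => //; first by apply/forall_inP => e /ME/E3b.
  by apply: contra freeE; apply/has_berge_cycleS/subsetP.
(* The factor 4 comes from the colouring, the 3 from [linear_subfamily] with [d = 2]. *)
rewrite cardE (_ : 12 = 4 * 3) // -mulnA -addnA -mulnDr; apply: leq_add E1le _.
by apply: leq_trans cle _; rewrite leq_mul2l /= cardS leq_add.
Qed.
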